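(* Let $n\ge 1$ and $\vec a=(a_0,\dots,a_n)\in\mathbb{Z}^{n+1}$. If the tropical entropy satisfies $H_{\vec a}>0$, then $H_{\vec a}\ge 1/4$. This bound is sharp: there exists an integer vector $\vec a$ with $H_{\vec a}=1/4$.
   Context: A sequence $(z_1,\dots,z_k)\in\mathbb{R}^k$ satisfies $\vec a$ if for every $1\le j\le k-n$ the minimum $\min_{0\le i\le n}\{z_{j+i}+a_i\}$ is attained for at least two different values of $i$. $D(k)\subset\mathbb{R}^k$ denotes the set of all such sequences; it is a finite union of polyhedra. Put $d_{\vec a}(k):=\dim D(k)$ (the maximal dimension of a polyhedron in this union). The tropical entropy is $H_{\vec a}:=\lim_{k\to\infty}d_{\vec a}(k)/k$; the limit exists since $d_{\vec a}(k+t)\le d_{\vec a}(k)+d_{\vec a}(t)$. *)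

(* Defs.v *)
From HB Require Import structures.
From mathcomp Require Import all_boot all_order all_algebra.
From mathcomp Require Import all_classical all_reals all_analysis.

Set Implicit Arguments.
Unset Strict Implicit.
Unset Printing Implicit Defensive.

Import Order.TTheory GRing.Theory Num.Theory.
Import numFieldNormedType.Exports.

Local Open Scope classical_set_scope.
Local Open Scope ring_scope.

Definition polyhedron (R : realType) (k : nat) (P : set 'rV[R]_k) : Prop :=
  exists (m : nat) (A : 'M[R]_(k, m)) (b : 'rV[R]_m),
    P = [set x | forall i, (x *m A) 0 i <= b 0 i].

(* The largest d such that P contains d + 1 affinely independent points
   x, x + v_1, ..., x + v_d, i.e. the dimension of the affine hull of P
   (with value 0 instead of -1 when P is empty). *)
Definition affine_dim (R : realType) (k : nat) (P : set 'rV[R]_k) : nat :=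
  (\max_(d < k.+1 |
     `[< exists (x : 'rV[R]_k) (V : 'M[R]_(d, k)),
           [/\ P x, forall i, P (x + row i V)%R & row_free V] >]) d)%N.

(* When S is a finite union of polyhedra, this is the maximal dimension of a
   member of the union, for any way of writing S as such a union: a polyhedron
   is never covered by finitely many polyhedra of smaller dimension. *)
Definition polyhedral_dim (R : realType) (k : nat) (S : set 'rV[R]_k) : nat :=
  (\max_(d < k.+1 |
     `[< exists P : set 'rV[R]_k,
           [/\ polyhedron P, P `<=` S & affine_dim P = d] >]) d)%N.

Definition min_attained_twice (R : realType) (I : finType) (f : I -> R) : Prop :=
  exists i1 i2 : I,
    [/\ i1 != i2, forall i, f i1 <= f i & forall i, f i2 <= f i].

Lemma window_subproof (n k : nat) (j : 'I_(k - n)) (i : 'I_n.+1) :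
  (j + i < k)%N.
Proof.
have jn : (j + n < k)%N by rewrite addnC -ltn_subRL ltn_ord.
by apply: leq_ltn_trans jn; rewrite leq_add2l -ltnS.
Qed.

(* Coordinates are numbered from 0, so the windows start at 0 <= j < k - n;
   there is none when k <= n, in which case D(k) is the whole space. *)
Definition window (n k : nat) (j : 'I_(k - n)) (i : 'I_n.+1) : 'I_k :=
  Ordinal (window_subproof j i).

Definition tropical_recurrent (R : realType) (n : nat) (a : 'rV[int]_n.+1)
    (k : nat) : set 'rV[R]_k :=
  [set z | forall j : 'I_(k - n),
     min_attained_twice (fun i : 'I_n.+1 => z 0 (window j i) + (a 0 i)%:~R)].

Definition recurrent_dim (R : realType) (n : nat) (a : 'rV[int]_n.+1)
    (k : nat) : nat :=
  polyhedral_dim (@tropical_recurrent R n a k).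

Definition tropical_entropy (R : realType) (n : nat) (a : 'rV[int]_n.+1) : R :=
  limn (fun k : nat => (recurrent_dim R a k)%:R / k%:R : R).

(* Main.v *)
(* On a polyhedron contained in D(k), a generic point has only those ties that
   hold on the whole polyhedron, so the dimension is at most the number of
   classes of positions identified by the ties of one sequence.
   - If a is strictly convex, minimal positions move to the right with the
     window, so each window identifies a new position with an earlier one:
     d(k) <= n and the entropy vanishes.
   - Otherwise, up to an affine function, a >= 0 with a_p = a_q = 0 and
     q - p >= 2. If there is a third zero, colour the integers with four colours
     so that no two of the three zeros of a window have the same colour; the
     positions of the largest colour are free and nonnegative, the others are 0.
     If there is none, put on each residue class mod q - p a level, namely its
     shortest distance to some root classes, where the sequence is 0; off the
     roots the sequence exceeds the level on a suitable set of positions, with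
     q - p free parameters for every 4 (q - p) positions. So d(k) >= k/4 - C.
   - For a = (0,1,0), positions not identified with an earlier one are at least
     4 apart, which makes the bound 1/4 sharp. *)
Require Import Defs.
From mathcomp Require Import all_boot all_order all_algebra.
From mathcomp Require Import all_classical all_reals all_analysis.
From mathcomp Require Import zify ring lra.

Set Implicit Arguments.
Unset Strict Implicit.
Unset Printing Implicit Defensive.

Import Order.TTheory GRing.Theory Num.Theory.
Import numFieldNormedType.Exports.
Local Open Scope ring_scope.

(** * Dimension of polyhedral sets *)

Lemma affine_dim_ge (R : realType) (k d : nat) (P : set 'rV[R]_k)
    (x : 'rV[R]_k) (V : 'M[R]_(d, k)) :
  P x -> (forall i, P (x + row i V)) -> row_free V -> (d <= affine_dim P)%N.
Proof.
move=> Px PV Vf.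
have dk : (d < k.+1)%N by rewrite ltnS -(eqP Vf) rank_leq_col.
apply: (@leq_bigmax_cond _ _ (fun i : 'I_k.+1 => i : nat) (Ordinal dk)).
by apply/asboolP; exists x, V.
Qed.

Lemma affine_dim_le (R : realType) (k : nat) (P : set 'rV[R]_k) :
  (affine_dim P <= k)%N.
Proof. by apply/bigmax_leqP => i _; rewrite -ltnS. Qed.

Lemma affine_dim_le_polyhedral_dim (R : realType) (k : nat)
    (S P : set 'rV[R]_k) :
  polyhedron P -> (P `<=` S)%classic -> (affine_dim P <= polyhedral_dim S)%N.
Proof.
move=> polyP PS.
have dk : (affine_dim P < k.+1)%N by rewrite ltnS affine_dim_le.
apply: (@leq_bigmax_cond _ _ (fun i : 'I_k.+1 => i : nat) (Ordinal dk)).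
by apply/asboolP; exists P.
Qed.

Lemma polyhedral_dim_le (R : realType) (k N : nat) (S : set 'rV[R]_k) :
  (forall (d : nat) (P : set 'rV[R]_k) (x : 'rV[R]_k) (V : 'M[R]_(d, k)),
     polyhedron P -> (P `<=` S)%classic -> P x ->
     (forall i, P (x + row i V)) -> row_free V -> (d <= N)%N) ->
  (polyhedral_dim S <= N)%N.
Proof.
move=> H; apply/bigmax_leqP => i /asboolP[P [polyP PS <-]].
by apply/bigmax_leqP => d /asboolP[x [V [Px PV Vf]]]; apply: (H d P x V).
Qed.

(** A right inverse [G] of [V] reads off the coordinates and [K] vanishes on the row space of [V]:
    the set is given by [y *m K = x *m K] and by bounds on [y *m G], each equation being two
    inequalities. *)
Lemma polyhedron_parallelepiped (R : realType) (k d : nat) (x : 'rV[R]_k)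
    (V : 'M[R]_(d, k)) :
  row_free V ->
  polyhedron [set y | exists2 g : 'rV[R]_d,
    forall i, 0 <= g 0 i <= 1 & y = x + g *m V]%classic.
Proof.
move=> /row_freeP[G VG].
pose K := 1%:M - G *m V : 'M[R]_k.
exists (d + d + (k + k))%N, (row_mx (row_mx G (- G)) (row_mx K (- K))),
  (row_mx (row_mx (const_mx 1 + x *m G) (- (x *m G)))
     (row_mx (x *m K) (- (x *m K)))).
apply/seteqP; split=> y /=.
  move=> [g g01 ->] i.
  have yG : (x + g *m V) *m G = x *m G + g by rewrite mulmxDl -mulmxA VG mulmx1.
  have yK : (x + g *m V) *m K = x *m K.
    have VK : V *m K = 0 by rewrite mulmxBr mulmx1 mulmxA VG mul1mx subrr.
    by rewrite mulmxDl -mulmxA VK mulmx0 addr0.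
  rewrite !mul_mx_row !mulmxN yG yK.
  case: (split_ordP i) => {}i ->; rewrite ?row_mxEl ?row_mxEr;
    case: (split_ordP i) => {}i ->; rewrite ?row_mxEl ?row_mxEr !mxE //.
  - by have /andP[_ ?] := g01 i; lra.
  - by have /andP[? _] := g01 i; lra.
move=> Hy.
have Gle i : (y *m G) 0 i <= 1 + (x *m G) 0 i.
  have := Hy (lshift _ (lshift _ i)).
  by rewrite !mul_mx_row !row_mxEl [(const_mx _ + _) _ _]mxE [const_mx _ _ _]mxE.
have Gge i : (x *m G) 0 i <= (y *m G) 0 i.
  have := Hy (lshift _ (rshift _ i)).
  by rewrite !mul_mx_row !row_mxEl !row_mxEr mulmxN !mxE lerN2.
have Kle i : (y *m K) 0 i <= (x *m K) 0 i.
  have := Hy (rshift _ (lshift _ i)).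
  by rewrite !mul_mx_row !row_mxEr !row_mxEl.
have Kge i : (x *m K) 0 i <= (y *m K) 0 i.
  have := Hy (rshift _ (rshift _ i)).
  rewrite !mul_mx_row !row_mxEr mulmxN [X in X <= _]mxE [X in _ <= X]mxE.
  by rewrite lerN2.
have KE : y *m K = x *m K.
  by apply/rowP => i; apply/eqP; rewrite eq_le Kle Kge.
exists ((y - x) *m G).
  by move=> i; rewrite mulmxBl !mxE; have := Gle i; have := Gge i; rewrite !mxE; lra.
move: KE; rewrite !mulmxBr !mulmx1 !mulmxA mulmxBl mulmxBl => KE.
by rewrite -[LHS](subrK (y *m G *m V)) KE -addrA [- _ + _]addrC.
Qed.

(* The coordinates with [f t = Some i] share the i-th free parameter. *)
Lemma polyhedral_dim_ge (R : realType) (k d : nat) (S : set 'rV[R]_k)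
    (h : 'I_k -> R) (f : 'I_k -> option 'I_d) (eps : R) :
  0 < eps -> (forall i, exists t, f t = Some i) ->
  (forall g : 'I_d -> R, (forall i, 0 <= g i <= 1) ->
     S (\row_t (h t + eps * oapp g 0 (f t)))) ->
  (d <= polyhedral_dim S)%N.
Proof.
move=> e0 fsurj HS.
pose V := \matrix_(i < d, t < k) (eps * (f t == Some i)%:R).
have gV (g : 'rV[R]_d) t : (g *m V) 0 t = eps * oapp (g 0) 0 (f t).
  rewrite mxE; case ft : (f t) => [i|] /=; last first.
    by rewrite mulr0 big1 // => i _; rewrite mxE ft mulr0 mulr0.
  rewrite (bigD1 i) //= big1 ?addr0; first by rewrite mxE ft eqxx mulr1 mulrC.
  by move=> l li; rewrite mxE ft [_ == _]eq_sym (inj_eq Some_inj) (negbTE li) !mulr0.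
have Vf : row_free V.
  rewrite -kermx_eq0; apply/eqP/row_matrixP => l; rewrite row0.
  have : row l (kermx V) *m V = 0 by rewrite -row_mul mulmx_ker row0.
  move: (row l _) => g g0; apply/rowP => i; rewrite mxE.
  (* At such a position only row [i] of [V] is nonzero, so the relation isolates [g 0 i]. *)
  have [t ft] := fsurj i.
  move/rowP: g0 => /(_ t); rewrite gV ft mxE /= => /eqP.
  by rewrite mulf_eq0 gt_eqF //= => /eqP.
pose x := \row_t h t.
have polyP := polyhedron_parallelepiped x Vf.
set P := mkset _ in polyP.
have PS : (P `<=` S)%classic.
  move=> _ [g g01 ->]; suff -> : x + g *m V = \row_t (h t + eps * oapp (g 0) 0 (f t)).
    by apply: HS => i; apply: g01.
  by apply/rowP => t; rewrite mxE gV !mxE.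
apply: leq_trans (affine_dim_le_polyhedral_dim polyP PS).
apply: (@affine_dim_ge _ _ _ _ x V) => //.
  by exists 0 => [i|]; rewrite ?mxE ?lexx ?ler01 // mul0mx addr0.
move=> i; exists (delta_mx 0 i); last by rewrite rowE.
by move=> l; rewrite mxE /=; case: (_ == _); rewrite /= ?ler01 ?lexx.
Qed.

Lemma nonroot_small (R : realType) (p : {poly R}) (e : R) :
  p != 0 -> 0 < e -> exists2 s, 0 < s < e & p.[s] != 0.
Proof.
move=> p0 e0; pose u (i : nat) := e / i.+2%:R.
have uinj : injective u.
  move=> i j /(mulfI (lt0r_neq0 e0)) /invr_inj /eqP.
  by rewrite eqr_nat => /eqP [].
pose s := map u (iota 0 (size p)).
have su : uniq s by rewrite map_inj_uniq ?iota_uniq.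
case: (boolP (all (root p) s)) => [ar|/allPn[_ /mapP[i _ ->] pi]].
  by have := max_poly_roots p0 ar su; rewrite size_map size_iota ltnn.
exists (u i) => //; rewrite /u divr_gt0 ?ltr0n //=.
by rewrite ltr_pdivrMr ?ltr0n // ltr_pMr // ltr1n.
Qed.

Lemma polyhedron_convex (R : realType) (k d : nat) (P : set 'rV[R]_k)
    (x : 'rV[R]_k) (V : 'M[R]_(d, k)) (g : 'rV[R]_d) :
  polyhedron P -> P x -> (forall i, P (x + row i V)) ->
  (forall i, 0 <= g 0 i) -> \sum_i g 0 i <= 1 -> P (x + g *m V).
Proof.
move=> [m [A [b ->]]] /= Px PV g0 g1 j.
rewrite mulmxDl mxE -mulmxA [X in _ + X]mxE.
have -> : b 0 j = (1 - \sum_i g 0 i) * b 0 j + \sum_i g 0 i * b 0 j.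
  by rewrite -mulr_suml mulrBl mul1r subrK.
have -> : (x *m A) 0 j + \sum_i g 0 i * (V *m A) i j =
   (1 - \sum_i g 0 i) * (x *m A) 0 j
   + \sum_i g 0 i * ((x + row i V) *m A) 0 j.
  under [X in _ = _ + X]eq_bigr => i _.
    rewrite mulmxDl -row_mul mxE [row _ _ _ _]mxE mulrDr; over.
  by rewrite big_split /= -mulr_suml; ring.
apply: lerD; first by rewrite ler_wpM2l // subr_ge0.
by apply: ler_sum => i _; rewrite ler_wpM2l.
Qed.

(** Finiteness of [E] is what matters: each tie not shared by all directions in [V] excludes only
    finitely many points of a curve in [P]. *)
Lemma generic_point (R : realType) (k d : nat) (P : set 'rV[R]_k)
    (x : 'rV[R]_k) (V : 'M[R]_(d, k)) (E : seq R) :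
  polyhedron P -> P x -> (forall i, P (x + row i V)) ->
  exists2 z, P z & forall t t' e, e \in E ->
    z 0 t = z 0 t' + e -> col t V = col t' V.
Proof.
move=> polyP Px PV.
(* The point [x + s v_1 + s^2 v_2 + ...] with s small: the tie [(t, t', e)]
   is a polynomial equation in s. *)
pose u (t t' : 'I_k) := (col t V - col t' V)^T.
pose Q (w : 'I_k * 'I_k * R) :=
  (x 0 w.1.1 - x 0 w.1.2 - w.2)%:P + 'X * rVpoly (u w.1.1 w.1.2).
pose L := [seq w <- [seq (w, e) | w <- enum (('I_k * 'I_k)%type : finType), e <- E]
            | u w.1.1 w.1.2 != 0].
have Q0 : \prod_(w <- L) Q w != 0.
  rewrite prodf_seq_neq0; apply/allP => w; rewrite mem_filter => /andP[uw _].
  apply/implyP => _; apply: contraNneq uw => Qw.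
  apply/eqP/rowP => i; rewrite [RHS]mxE -coef_rVpoly_ord.
  have := congr1 (fun q : {poly R} => q`_i.+1) Qw.
  by rewrite coefD coefC coefXM coef0 /= add0r.
have [s /andP[s0 sd] Qs] := @nonroot_small _ _ (d.+1%:R^-1) Q0 ltac:(by rewrite invr_gt0).
have s1 : s <= 1.
  by apply: le_trans (ltW sd) _; rewrite invf_le1 ?ler1n.
pose g := \row_(i < d) s ^+ i.+1.
exists (x + g *m V).
  apply: polyhedron_convex => // [i|]; first by rewrite mxE exprn_ge0 // ltW.
  apply: (@le_trans _ _ (\sum_(i < d) d.+1%:R^-1)).
    apply: ler_sum => i _; rewrite mxE exprS.
    by apply: le_trans (ltW sd); apply: ler_piMr; rewrite ?exprn_ile1 // ltW.
  by rewrite sumr_const card_ord -[_ *+ d]mulr_natl ler_pdivrMr ?ltr0n // mul1r ler_nat.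
move=> t t' e eE zt; apply/eqP; rewrite -subr_eq0; apply/negPn/negP => u0.
have : (Q ((t, t'), e)).[s] != 0.
  move: Qs; rewrite horner_prod prodf_seq_neq0 => /allP/(_ ((t, t'), e)).
  apply; rewrite mem_filter /=.
  rewrite /u trmx_eq0 u0; apply/allpairsP; exists ((t, t'), e).
  by rewrite mem_enum.
move/eqP; apply; rewrite /Q /= !hornerE (@horner_coef_wide _ d) ?size_poly //.
move: zt; rewrite !mxE => zt.
have -> : x 0 t - x 0 t' - e = \sum_j g 0 j * V j t' - \sum_j g 0 j * V j t by lra.
rewrite mulr_sumr -sumrB -big_split big1 //= => i _.
by rewrite coef_rVpoly_ord !mxE exprS; ring.
Qed.

(** A combination of the rows that vanishes on the first occurrences of the columns vanishes
    everywhere, so these columns already have rank [d]. *)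
Lemma rank_le_new_columns (R : realType) (d k : nat) (V : 'M[R]_(d, k)) :
  row_free V ->
  (d <= #|[set t : 'I_k | [forall s : 'I_k, (s < t) ==> (col s V != col t V)]]|)%N.
Proof.
move=> Vf; set N := finset _.
pose W := colsub (fun i : 'I_#|N| => enum_val i) V.
suff Wf : row_free W by rewrite -(eqP Wf) rank_leq_col.
rewrite -kermx_eq0; apply/eqP/row_matrixP => l; rewrite row0.
have : row l (kermx W) *m W = 0 by rewrite -row_mul mulmx_ker row0.
move: (row l _) => g g0.
apply: (row_free_inj Vf); rewrite mul0mx.
apply/rowP => t; rewrite [RHS]mxE.
have [b] := ubnP (val t); elim: b t => // b IH t tb.
have [tN|] := boolP (t \in N).
  move/rowP: g0 => /(_ (enum_rank_in tN t)); rewrite !mxE => g0.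
  rewrite -[RHS]g0; apply: eq_bigr => i _.
  by rewrite mxE (enum_rankK_in tN).
rewrite inE negb_forall => /existsP[s]; rewrite negb_imply negbK.
move=> /andP[st /eqP/colP E].
rewrite -(IH s); last by apply: leq_trans st _; rewrite -ltnS.
by rewrite !mxE; apply: eq_bigr => i _; have := E i; rewrite !mxE => ->.
Qed.

(** * Upper bounds *)

(** Turns dimension into counting: [z] stands for a generic point of a polyhedron in D(k), and [c t]
    for the column of directions at position [t], which respects all ties of [z]. *)
Lemma recurrent_dim_le (R : realType) (n k N : nat) (a : 'rV[int]_n.+1) :
  let al i : R := (a 0 (inord i))%:~R in
  (forall (z : nat -> R) (T : eqType) (c : nat -> T),
    (forall j, (j + n < k)%N -> exists i1 i2, [/\ (i1 < i2 <= n)%N,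
       forall i, (i <= n)%N -> z (j + i1)%N + al i1 <= z (j + i)%N + al i &
       forall i, (i <= n)%N -> z (j + i2)%N + al i2 <= z (j + i)%N + al i]) ->
    (forall j i i', (j + n < k)%N -> (i <= n)%N -> (i' <= n)%N ->
       z (j + i)%N + al i = z (j + i')%N + al i' ->
       c (j + i)%N = c (j + i')%N) ->
    (#|[set t : 'I_k | [forall s : 'I_k, (s < t) ==> (c s != c t)]]| <= N)%N) ->
  (recurrent_dim R a k <= N)%N.
Proof.
move=> al H; apply: polyhedral_dim_le => d P x V polyP PS Px PV Vf.
have alE (i : 'I_n.+1) : al i = (a 0 i)%:~R by rewrite /al inord_val.
(* A tie between the terms [i] and [i'] of a window reads [z t = z t' + e] with
   [e = al i' - al i]. *)
pose E := [seq al w.2 - al w.1 | w : 'I_n.+1 * 'I_n.+1].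
have [z Pz zE] := generic_point E polyP Px PV.
pose zz (t : nat) := oapp (z 0) 0 (insub t : option 'I_k).
pose cc (t : nat) := oapp (fun s => col s V) 0 (insub t : option 'I_k).
have zzE (t : 'I_k) : zz t = z 0 t by rewrite /zz valK.
have ccE (t : 'I_k) : cc t = col t V by rewrite /cc valK.
have Dz := PS _ Pz.
apply: leq_trans (rank_le_new_columns Vf) _.
suff : (#|[set t : 'I_k | [forall s : 'I_k, (s < t) ==> (cc s != cc t)]]| <= N)%N.
  apply: leq_trans; apply: subset_leq_card; apply/fintype.subsetP => t.
  by rewrite !inE => /forallP Ht; apply/forallP => s; rewrite !ccE.
apply: (H zz) => [j jn|j i i' jn ni ni'].
  have jn' : (j < k - n)%N by lia.
  have [i1 [i2 [i12 m1 m2]]] := Dz (Ordinal jn').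
  have F (i : 'I_n.+1) : zz (j + i)%N + al i =
      z 0 (window (Ordinal jn') i) + (a 0 i)%:~R.
    by rewrite -zzE alE.
  have G (l : 'I_n.+1) : (forall i : 'I_n.+1, z 0 (window (Ordinal jn') l) + (a 0 l)%:~R
    <= z 0 (window (Ordinal jn') i) + (a 0 i)%:~R) ->
     forall i, (i <= n)%N -> zz (j + l)%N + al l <= zz (j + i)%N + al i.
    move=> ml i; rewrite -ltnS => ni.
    by have := ml (Ordinal ni); rewrite -!F.
  case: (ltngtP i1 i2) => [lt|lt|/val_inj eq]; last by rewrite eq eqxx in i12.
  - by exists i1, i2; split; [rewrite lt -ltnS /= | apply: G | apply: G].
  - by exists i2, i1; split; [rewrite lt -ltnS /= | apply: G | apply: G].
move=> E1; rewrite -ltnS in ni; rewrite -ltnS in ni'.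
have jn' : (j < k - n)%N by lia.
have := zE (window (Ordinal jn') (Ordinal ni))
  (window (Ordinal jn') (Ordinal ni')) (al i' - al i).
rewrite -!ccE; apply; last first.
  by rewrite -!zzE /=; apply: (addIr (al i)); rewrite E1 /= addrA subrK.
by apply/mapP; exists (Ordinal ni, Ordinal ni'); rewrite ?mem_enum.
Qed.

Lemma strictly_convex_monge (n : nat) (A : nat -> int) :
  (forall i, (i.+2 <= n)%N -> A i.+1 *+ 2 < A i + A i.+2) ->
  forall u w e, (u < w)%N -> (0 < e)%N -> (w + e <= n)%N ->
    A w + A (u + e)%N < A u + A (w + e)%N.
Proof.
move=> cvx.
have step u e : (0 < e)%N -> (u.+1 + e <= n)%N ->
    A u.+1 + A (u + e)%N < A u + A (u.+1 + e)%N.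
  elim: e => // e IH _ ue; rewrite !addSn !addnS in ue *.
  have := cvx (u + e)%N ltac:(lia).
  case: e IH ue => [|e] IH ue; first by rewrite addn0; lia.
  by have := IH isT ltac:(lia); rewrite !addSn !addnS; lia.
move=> u w e; elim: w => // w IH; rewrite ltnS leq_eqVlt => /orP[/eqP->|uw] e0 we.
  exact: step.
by have := IH uw e0 ltac:(lia); have := step w e e0 we; lia.
Qed.

(** The second minimal position of each window is tied to the first, hence not new, and it strictly
    increases with the window: [k - n] positions are not new. *)
Lemma recurrent_dim_strictly_convex (R : realType) (n k : nat)
    (a : 'rV[int]_n.+1) :
  (forall i, (i.+2 <= n)%N ->
     a 0 (inord i.+1) *+ 2 < a 0 (inord i) + a 0 (inord i.+2)) ->
  (recurrent_dim R a k <= n)%N.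
Proof.
move=> /(@strictly_convex_monge n (fun i => a 0 (inord i))) monge.
apply: recurrent_dim_le => z T c minz tie.
set N := finset _; pose al i : R := (a 0 (inord i))%:~R.
have ex (j : 'I_(k - n)) : exists w : nat * nat, [/\ (w.1 < w.2 <= n)%N,
       forall i, (i <= n)%N -> z (j + w.1)%N + al w.1 <= z (j + i)%N + al i &
       forall i, (i <= n)%N -> z (j + w.2)%N + al w.2 <= z (j + i)%N + al i].
  have jn : (j + n < k)%N by have := ltn_ord j; lia.
  by have [i1 [i2 H]] := minz j jn; exists (i1, i2).
have [w Hw] := choice ex.
have tk (j : 'I_(k - n)) : (j + (w j).2 < k)%N.
  by have := ltn_ord j; have [/andP[_ ?] _ _] := Hw j; lia.
have sk (j : 'I_(k - n)) : (j + (w j).1 < k)%N.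
  by have := tk j; have [/andP[? _] _ _] := Hw j; lia.
pose f j := Ordinal (tk j).
have fN j : f j \notin N.
  rewrite inE negb_forall; apply/existsP; exists (Ordinal (sk j)).
  have [/andP[w12 w2n] m1 m2] := Hw j.
  rewrite /= ltn_add2l w12 /= negbK; apply/eqP.
  apply: tie => //; [by have := ltn_ord j; lia | by lia |].
  by apply/eqP; rewrite eq_le m1 ?m2 //; lia.
(* If the two positions crossed, both would lie in both windows, and the sum of the two minimality
   inequalities would contradict the Monge inequality. *)
have mono (j j' : 'I_(k - n)) : (j < j')%N -> (j + (w j).2 <= j' + (w j').1)%N.
  move=> jj'; rewrite leqNgt; apply/negP => lt.
  have [/andP[w12 w2n] m1 m2] := Hw j; have [/andP[w12' w2n'] m1' m2'] := Hw j'.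
  have := monge (w j').1 (j + (w j).2 - j')%N (j' - j)%N ltac:(lia) ltac:(lia) ltac:(lia).
  have := m2 ((w j').1 + (j' - j))%N ltac:(lia).
  have := m1' (j + (w j).2 - j')%N ltac:(lia).
  have -> : (j' + (j + (w j).2 - j') = j + (w j).2)%N by lia.
  have -> : (j + (w j).2 - j' + (j' - j) = (w j).2)%N by lia.
  have -> : (j + ((w j').1 + (j' - j)) = j' + (w j').1)%N by lia.
  rewrite /al -(@ltr_int R) !rmorphD /=; lra.
have finj : injective f.
  have lt (j j' : 'I_(k - n)) : (j < j')%N -> (f j < f j')%N.
    by move=> /mono; have [/andP[w12 _] _ _] := Hw j'; rewrite /=; lia.
  move=> j j' ff; case: (ltngtP j j') => [/lt|/lt|/val_inj //];
    by rewrite ff ltnn.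
have : (#|N| + #|f @: [set: 'I_(k - n)]| <= k)%N.
  rewrite -[X in (_ <= X)%N]card_ord -cardsUI [X in (_ + X)%N]eq_card0 ?addn0 ?max_card //.
  by move=> t; rewrite !inE; apply/negP => /andP[tN /imsetP[j _ tj]];
     have := fN j; rewrite -tj inE tN.
(* When [k <= n] there is no window, and the trivial bound [k] on the number of new positions is
   used. *)
rewrite card_imset // cardsT card_ord; have := max_card (mem N); rewrite card_ord.
by lia.
Qed.

Lemma recurrent_dim_010 (R : realType) (k : nat) :
  (recurrent_dim R (\row_(i < 3) ((i == 1%N :> nat)%:R : int)) k <= (k %/ 4).+3)%N.
Proof.
set a := \row_i _; apply: recurrent_dim_le => z T c.
have al0 : (a 0 (inord 0%N))%:~R = 0 :> R by rewrite mxE inordK.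
have al1 : (a 0 (inord 1%N))%:~R = 1 :> R by rewrite mxE inordK.
have al2 : (a 0 (inord 2%N))%:~R = 0 :> R by rewrite mxE inordK.
move=> minz tie; set N := finset _.
have {}minz j : (j + 2 < k)%N ->
    [\/ z j = z j.+1 + 1 /\ z j <= z j.+2, z j = z j.+2 /\ z j <= z j.+1 + 1 |
        z j.+1 + 1 = z j.+2 /\ z j.+2 <= z j].
  move=> /minz[i1 [i2 [/andP[i12 i2n] m1 m2]]].
  have := m1 0%N isT; have := m1 1%N isT; have := m1 2%N isT.
  have := m2 0%N isT; have := m2 1%N isT; have := m2 2%N isT.
  rewrite !addn0 !addn1 !addn2 al0 al1 al2 !addr0.
  case: i2 i2n i12 {m1 m2} => [|[|[|//]]] // _; case: i1 => [|[|//]] // _;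
    rewrite ?addn0 ?addn1 ?addn2 ?al0 ?al1 ?al2 ?addr0 => *;
    [apply: Or31|apply: Or32|apply: Or33]; split; lra.
have tie01 j : (j + 2 < k)%N -> z j = z j.+1 + 1 -> c j = c j.+1.
  by move=> jk; have := tie j 0%N 1%N jk isT isT; rewrite addn0 addn1 al0 al1 addr0.
have tie02 j : (j + 2 < k)%N -> z j = z j.+2 -> c j = c j.+2.
  by move=> jk; have := tie j 0%N 2%N jk isT isT; rewrite addn0 addn2 al0 al2 !addr0.
have tie12 j : (j + 2 < k)%N -> z j.+1 + 1 = z j.+2 -> c j.+1 = c j.+2.
  by move=> jk; have := tie j 1%N 2%N jk isT isT; rewrite addn1 addn2 al1 al2 !addr0.
have new (s : nat) (t : 'I_k) : t \in N -> (s < t)%N -> c s <> c t.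
  move=> tN st; have sk := ltn_trans st (ltn_ord t).
  by move: tN; rewrite inE => /forallP/(_ (Ordinal sk)); rewrite /= st => /eqP.
(* With [t = j + 2] new, window [j] takes its minimum at [j] and [j + 1]; normalising
   [z (j + 1) = 0] gives [z j = 1 < z (j + 2)]. The next three windows then force 0, 1, 0 at
   [j + 3], [j + 4], [j + 5], each tied to an earlier position. *)
have gap (t t' : 'I_k) : t \in N -> t' \in N -> (2 <= t)%N -> (t < t')%N ->
    (t + 4 <= t')%N.
  move=> tN t'N t2 tt'; rewrite leqNgt; apply/negP => t't.
  have t'k := ltn_ord t'.
  case tE : (nat_of_ord t) t2 => [|[|j]] // _.
  have jk : (j.+2 < k)%N by rewrite -tE.
  have jt' : (j.+2 < t')%N by rewrite -tE.
  have t'j : (t' < j.+2 + 4)%N by rewrite -tE.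
  have nct' s : (s < t')%N -> c s <> c t' by exact: new.
  have nc1 : c j.+1 <> c j.+2 by rewrite -tE; apply: new => //; rewrite tE.
  have nc0 : c j <> c j.+2 by rewrite -tE; apply: new => //; rewrite tE.
  have nz0 : z j <> z j.+2 by move=> /tie02 -/(_ ltac:(lia)).
  have nz1 : z j.+1 + 1 <> z j.+2 by move=> /tie12 -/(_ ltac:(lia)).
  have [z01 zlt] : z j = z j.+1 + 1 /\ z j < z j.+2.
    case: (minz j ltac:(lia)) => [[e l]|[e l]|[e l]] //; split=> //.
    by rewrite lt_neqAle l andbT; apply/eqP.
  have nc2 : z j.+2 <> z j.+1 + 1 by move=> e; apply: nz1.
  have z13 : z j.+1 = z j.+3.
    case: (minz j.+1 ltac:(lia)) => [[e l]|[e l]|[e l]] //; exfalso.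
      by apply: nc1; apply: tie01 => //; lia.
    by lra.
  have c13 := tie02 j.+1 ltac:(lia) z13.
  have [t'E|t'n3] := eqVneq (nat_of_ord t') j.+3.
    by case: (nct' j.+1); rewrite t'E.
  have z34 : z j.+3 + 1 = z j.+4.
    by case: (minz j.+2 ltac:(lia)) => [[e l]|[e l]|[e l]] //; lra.
  have c34 := tie12 j.+2 ltac:(lia) z34.
  have [t'E|t'n4] := eqVneq (nat_of_ord t') j.+4.
    by case: (nct' j.+3); rewrite t'E.
  have t'E : nat_of_ord t' = j.+4.+1 by lia.
  have z35 : z j.+3 = z j.+4.+1.
    by case: (minz j.+3 ltac:(lia)) => [[e l]|[e l]|[e l]] //; lra.
  have c35 := tie02 j.+3 ltac:(lia) z35.
  by case: (nct' j.+3); rewrite t'E //; lia.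
(* Positions 0 and 1 escape [gap] and get labels of their own; beyond them each block of four holds
   at most one new position. *)
pose f (t : 'I_k) : 'I_(k %/ 4).+3 :=
  inord (if (t < 2)%N then t : nat else (t %/ 4).+2)%N.
rewrite -[X in (_ <= X)%N]card_ord -(@card_in_imset _ _ f) ?max_card // => t t'.
have fE (u : 'I_k) : f u = (if (u < 2)%N then u : nat else (u %/ 4).+2)%N :> nat.
  by rewrite /f inordK //; have uk := ltn_ord u; case: (ltnP u 2) => u2; lia.
have lt (u u' : 'I_k) : u \in N -> u' \in N -> (u < u')%N -> f u <> f u'.
  move=> uN u'N uu' /(congr1 val) /=; rewrite !fE.
  have g := gap _ _ uN u'N; case: (ltnP u 2) => u2; case: (ltnP u' 2) => u2'; lia.
move=> tN t'N ff; case: (ltngtP t t') => [/lt|/lt|/val_inj //].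
  by move=> /(_ tN t'N).
by move=> /(_ t'N tN); rewrite ff.
Qed.

(** * Lower bounds *)

Definition min_twice_upto (R : realType) (n : nat) (F : nat -> R) : Prop :=
  exists i1 i2, [/\ i1 != i2, (i1 <= n)%N /\ (i2 <= n)%N,
    forall i, (i <= n)%N -> F i1 <= F i & forall i, (i <= n)%N -> F i2 <= F i].

(* Adding an affine function of the index to [a] does not change the dimension:
   it is compensated by an affine function of the position. *)
Lemma recurrent_dim_ge (R : realType) (n k d : nat) (a : 'rV[int]_n.+1)
    (b : nat -> R) (mu nu : R) (h : nat -> R) (f : nat -> option 'I_d) (eps : R) :
  (forall i, (i <= n)%N -> (a 0 (inord i))%:~R = b i + mu * i%:R + nu) ->
  0 < eps -> (forall i, exists2 t, (t < k)%N & f t = Some i) ->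
  (forall (g : 'I_d -> R) j, (forall i, 0 <= g i <= 1) -> (j + n < k)%N ->
     min_twice_upto n
       (fun i => h (j + i)%N + eps * oapp g 0 (f (j + i)%N) + b i)) ->
  (d <= recurrent_dim R a k)%N.
Proof.
move=> ab e0 fsurj Hf.
apply: (@polyhedral_dim_ge _ _ _ _ (fun t => h t - mu * t%:R) (fun t => f t) eps) => //.
  by move=> i; have [t tk ft] := fsurj i; exists (Ordinal tk).
move=> g g01 j; have jn : (j + n < k)%N by have := ltn_ord j; lia.
have [i1 [i2 [i12 [ni1 ni2] m1 m2]]] := Hf g j g01 jn.
have aE (i : 'I_n.+1) : (a 0 i)%:~R = b i + mu * i%:R + nu.
  by rewrite -ab ?inord_val // -ltnS.
have E (i : 'I_n.+1) : (\row_(t < k) (h t - mu * t%:R + eps * oapp g 0 (f t))) 0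
     (window j i) + (a 0 i)%:~R
   = h (j + i)%N + eps * oapp g 0 (f (j + i)%N) + b i + (nu - mu * j%:R).
  by rewrite mxE aE /= natrD; ring.
exists (inord i1), (inord i2); split.
- by apply: contra i12 => /eqP/(congr1 val); rewrite /= !inordK // => ->.
- by move=> i; rewrite !E lerD2r inordK // m1 // -ltnS.
- by move=> i; rewrite !E lerD2r inordK // m2 // -ltnS.
Qed.

(* Among d1, d2, d1 + d2, at least two have the lowest 2-adic valuation [r]
   and the bit [r] of [t] separates t from t + d for these; a block length
   equal to the third one takes care of it. *)
Lemma four_coloring (d1 d2 : nat) : (0 < d1)%N -> (0 < d2)%N ->
  exists c : nat -> bool * bool, forall t,
    [/\ c (t + d1)%N != c t, c (t + d2)%N != c t & c (t + (d1 + d2))%N != c t].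
Proof.
move=> d10 d20.
have [r [q1 [q2 [d1E d2E odd12]]]] : exists r q1 q2,
    [/\ d1 = (2 ^ r * q1)%N, d2 = (2 ^ r * q2)%N & odd q1 || odd q2].
  have [b] := ubnP d1; elim: b d1 d2 d10 d20 => // b IH {}d1 {}d2 d10 d20 d1b.
  have [oo|/norP[q1 q2]] := boolP (odd d1 || odd d2).
    by exists 0%N, d1, d2; rewrite !mul1n.
  have [| | | r [x [y [dx dy xy]]]] := IH d1./2 d2./2; [lia..|].
  exists r.+1, x, y; rewrite expnS -!mulnA -dx -dy; by split; rewrite ?mul2n ?even_halfK.
rewrite {}d1E {}d2E in d10 d20 *.
have r0 : (0 < 2 ^ r)%N by rewrite expn_gt0.
have {d10} q10 : (0 < q1)%N by move: d10; rewrite muln_gt0 r0.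
have {d20} q20 : (0 < q2)%N by move: d20; rewrite muln_gt0 r0.
pose E := (2 ^ r * (if odd q1 then if odd q2 then q1 + q2 else q2 else q1))%N.
have E0 : (0 < E)%N.
  rewrite muln_gt0 r0 /=; case: ifP odd12 => q1o /= odd12; last by lia.
  by case: ifP => q2o; lia.
exists (fun t => (odd (t %/ 2 ^ r), odd (t %/ E))) => t.
have c1 o : odd o -> odd ((t + 2 ^ r * o) %/ 2 ^ r) != odd (t %/ 2 ^ r).
  by move=> oo; rewrite mulnC divnDMl // oddD oo; case: (odd _).
have c2 : odd ((t + E) %/ E) != odd (t %/ E).
  by rewrite -{1}[E]mul1n divnDMl // oddD; case: (odd _).
have pairN1 (x y x' y' : bool) : x != x' -> (x, y) != (x', y').
  by apply: contra => /eqP[-> _].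
have pairN2 (x y x' y' : bool) : y != y' -> (x, y) != (x', y').
  by apply: contra => /eqP[_ ->].
move: c2; rewrite /E -mulnDr; case: ifP odd12 => q1o /= odd12.
  case: ifP => q2o c2; split; try by apply: pairN1; apply: c1.
    by apply: pairN2.
  - by apply: pairN2.
  - by apply: pairN1; apply: c1; rewrite oddD q1o q2o.
move=> c2; split; try by apply: pairN1; apply: c1.
  by apply: pairN2.
by apply: pairN1; apply: c1; rewrite oddD q1o.
Qed.

Lemma largest_color_class (T : finType) (k : nat) (c : nat -> T) :
  (0 < #|T|)%N -> exists x, (k <= #|T| * #|[set t : 'I_k | c t == x]|)%N.
Proof.
move=> T0; apply/existsP; apply: contraT; rewrite negb_exists => /forallP H.
have : (\sum_(x : T) #|T| * #|[set t : 'I_k | c t == x]| < \sum_(x : T) k)%N.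
  have /card_gt0P[x0 _] := T0.
  rewrite (bigD1 x0) //= [X in (_ < X)%N](bigD1 x0) //= -addSn leq_add //.
    by rewrite ltnNge H.
  by apply: leq_sum => x _; rewrite ltnW // ltnNge H.
rewrite -big_distrr /= sum_nat_const ltn_mul2l T0 /= ltnNge; apply: contraNT => _.
rewrite -{1}[k]card_ord -sum1_card (partition_big (fun t : 'I_k => c t) xpredT) //=.
by apply: leq_sum => x _; rewrite -sum1_card; under [X in (_ <= X)%N]eq_bigl do rewrite inE.
Qed.

(** All terms are nonnegative, and of the three positions over the zeros of [b] at most one has the
    free colour; the other two attain the minimum 0. *)
Lemma recurrent_dim_ge_three_zeros (R : realType) (n k : nat) (a : 'rV[int]_n.+1)
    (b : nat -> R) (mu nu : R) (u v w : nat) :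
  (forall i, (i <= n)%N -> (a 0 (inord i))%:~R = b i + mu * i%:R + nu) ->
  (forall i, (i <= n)%N -> 0 <= b i) ->
  (u < v < w)%N -> (w <= n)%N -> b u = 0 -> b v = 0 -> b w = 0 ->
  (k <= 4 * recurrent_dim R a k)%N.
Proof.
move=> ab b0 /andP[uv vw] wn bu bv bw.
have [|| c Hc] := @four_coloring (v - u) (w - v); [lia..|].
have [|x kx] := @largest_color_class (bool * bool)%type k c.
  by rewrite card_prod card_bool.
rewrite card_prod card_bool in kx.
apply: leq_trans kx _; rewrite leq_pmul2l //; set F := finset _.
pose f t := [pick i : 'I_#|F| | enum_val i == t :> nat].
have fx t : c t != x -> f t = None.
  rewrite /f; case: pickP => // i /eqP <-.
  by have := enum_valP i; rewrite inE => ->.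
apply: (@recurrent_dim_ge _ _ _ _ _ b mu nu (fun=> 0) f 1) => //.
  move=> i; exists (enum_val i); first exact: ltn_ord.
  rewrite /f; case: pickP => [i' /eqP/val_inj/enum_val_inj -> //|].
  by move/(_ i); rewrite eqxx.
move=> g j g01 jn.
pose y t : R := 0 + 1 * oapp g 0 (f t).
have y0 t : 0 <= y t.
  rewrite /y add0r mul1r; case: (f t) => [i|] //=.
  by have /andP[] := g01 i.
have yx t : c t != x -> y t = 0 by move=> /fx; rewrite /y => ->; rewrite mulr0 addr0.
have min0 i : (i <= n)%N -> c (j + i)%N != x -> b i = 0 ->
    forall l, (l <= n)%N -> y (j + i)%N + b i <= y (j + l)%N + b l.
  by move=> _ /yx -> -> l ln; rewrite addr0 addr_ge0 // b0.
have [c1 _ c12] := Hc (j + u)%N; have [_ c2 _] := Hc (j + v)%N.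
have ju : (j + u + (v - u) = j + v)%N by lia.
have jv : (j + v + (w - v) = j + w)%N by lia.
have jw : (j + u + (v - u + (w - v)) = j + w)%N by lia.
rewrite {}ju {}jv {}jw in c1 c12 c2.
have [cu|cu] := eqVneq (c (j + u)%N) x.
  exists v, w; split; [lia|split; lia|apply: min0|apply: min0]; rewrite -?cu //; lia.
have [cv|cv] := eqVneq (c (j + v)%N) x.
  exists u, w; split; [lia|split; lia|apply: min0|apply: min0]; rewrite -?cv //; try lia.
  by rewrite eq_sym.
by exists u, v; split; [lia|split; lia|apply: min0|apply: min0] => //; lia.
Qed.

Lemma maximal_shift_disjoint (Z : finZmodType) (D : Z) : D != 0 ->
  exists M : {set Z}, (forall r, r \in M -> r + D \notin M) /\
    (forall r, r \notin M -> r - D \notin M -> r + D \in M).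
Proof.
move=> D0; pose P (M : {set Z}) := [forall r in M, r + D \notin M].
have [M /maxsetP[/forall_inP PM maxM]] : {M | maxset P M}.
  by apply: ex_maxset; exists finset.set0; apply/forall_inP => r; rewrite inE.
exists M; split=> // r rM rDM; apply/negPn/negP => rDM'.
(* If [r + D] were outside [M] too, adjoining [r] would keep the set disjoint from its shift,
   against maximality; [D != 0] excludes [r + D = r]. *)
have/maxM/(_ (finset.subsetUr _ _)) E : P (r |: M).
  apply/forall_inP => x; rewrite !inE => /predU1P[->|xM].
    by rewrite negb_or rDM' andbT -subr_eq0 addrAC subrr add0r.
  rewrite negb_or PM // andbT; apply: contraNneq rDM => <-.
  by rewrite addrK.
by move/negP: rM; apply; rewrite -E setU11.
Qed.

(* The levels are the shortest distances to the roots [K0] in the graph with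
   edges r -> r + s i of length b i; classes of [K1] are joined to a root by an
   edge of the least length, and [K0 = M + D] for a maximal [M] disjoint from
   its shift [M + D], so that [K1] is at least as large as [K0]. *)
Lemma level_structure (R : realType) (Z : finZmodType) (I : finType)
    (s : I -> Z) (b : I -> R) :
  (exists i, s i != 0) -> (forall i, s i != 0 -> 0 < b i) ->
  exists (K0 K1 : {set Z}) (lev : Z -> R) (D : Z),
    [/\ [/\ forall r, r \in K0 -> lev r = 0 /\ r - D \in K1,
            forall r, r \in K1 -> r \notin K0 /\
              exists i, [/\ s i != 0, r + s i \in K0 & lev r = b i] &
            forall r, r \notin K0 -> r \notin K1 ->
              exists i, [/\ s i != 0, (r + s i \in K0) || (r + s i \in K1) &
                lev r = lev (r + s i) + b i]],
        forall r i, s i != 0 -> lev r <= lev (r + s i) + b i &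
        forall r i, s i != 0 -> r \notin K0 -> r \notin K1 ->
          r + s i \notin K0 -> r + s i \notin K1 ->
          lev r < lev (r + s i) + b i].
Proof.
move=> [i1 si1] bpos.
have [i0 si0 cmin] := @arg_minP _ _ _ i1 (fun i => s i != 0) b si1; set c := b i0 in cmin.
have c0 : 0 < c by exact: bpos.
have [M [Mdis Mmax]] := maximal_shift_disjoint si0; set D := s i0 in Mdis Mmax.
pose K0 := [set r | r - D \in M].
pose K1 := [set r | (r \notin K0) &&
  [exists i, [&& s i != 0, r + s i \in K0 & b i == c]]].
have MK1 r : r \in M -> r \in K1.
  move=> rM; rewrite !inE; apply/andP; split.
    by apply/negP => /Mdis; rewrite subrK rM.
  by apply/existsP; exists i0; rewrite si0 inE addrK rM eqxx.
have K10 r : r \in K1 -> r \notin K0 by rewrite inE => /andP[].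
pose lev1 r : R := if r \in K0 then 0 else c.
pose Q r i := (s i != 0) && ((r + s i \in K0) || (r + s i \in K1)).
(* The minimum is over a nonempty set: [r] lies neither in [M], which is contained in [K1], nor in
   [K0 = M + D], so [r + D] is in [M] by maximality and [i0] is an admissible edge. *)
have ex r : exists i, r \notin K0 -> r \notin K1 -> Q r i /\
    forall l, Q r l -> lev1 (r + s i) + b i <= lev1 (r + s l) + b l.
  have [rK|rK] := boolP ((r \in K0) || (r \in K1)).
    by exists i0 => r0 r1; move: rK; rewrite (negbTE r0) (negbTE r1).
  have Q0 : Q r i0.
    move/norP: rK => [r0 r1]; rewrite /Q si0 /= MK1 ?orbT //.
    by apply: Mmax; [apply: contra r1 => /MK1 | move: r0; rewrite inE].
  by have [i Qi mi] :=
    @arg_minP _ _ _ i0 (Q r) (fun i => lev1 (r + s i) + b i) Q0; exists i.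
have [best Hbest] := choice ex.
pose lev r := if (r \in K0) || (r \in K1) then lev1 r
              else lev1 (r + s (best r)) + b (best r).
have lev1_ge0 r : 0 <= lev1 r by rewrite /lev1; case: ifP => // _; apply: ltW.
have lev_ge0 r : 0 <= lev r.
  rewrite /lev; case: ifP => // /negbT/norP[r0 r1].
  have [/andP[sb _] _] := Hbest r r0 r1.
  by rewrite addr_ge0 // ltW // bpos.
have levK01 r : (r \in K0) || (r \in K1) -> lev r = lev1 r by rewrite /lev => ->.
have lev2_le r : r \notin K0 -> r \notin K1 -> lev r <= c + c.
  move=> r0 r1; rewrite /lev (negbTE r0) (negbTE r1) /=.
  have [_ /(_ i0) H] := Hbest r r0 r1.
  apply: le_trans (H _) _; last by rewrite lerD2r /lev1; case: ifP => // _; apply: ltW.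
  rewrite /Q si0 /= MK1 ?orbT //.
  by apply: Mmax; [apply: contra r1 => /MK1 | move: r0; rewrite inE].
have lev2_gt r : r \notin K0 -> r \notin K1 -> c < lev r.
  move=> r0 r1; rewrite /lev (negbTE r0) (negbTE r1) /=.
  have [/andP[sb bK] _] := Hbest r r0 r1; have bc := cmin _ sb.
  rewrite /lev1; case: ifP bK => [rb _|rb /= rb1]; last by lra.
  rewrite add0r lt_neqAle bc andbT; apply: contra r1 => bE.
  by rewrite inE r0; apply/existsP; exists (best r); rewrite sb rb eq_sym bE.
(* Outside [K0] and [K1] the levels exceed [c] and are at most [c + c], so an edge between two such
   classes, of length at least [c], is never tight. *)
have lev_strict r i : s i != 0 -> r \notin K0 -> r \notin K1 ->
    r + s i \notin K0 -> r + s i \notin K1 -> lev r < lev (r + s i) + b i.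
  move=> si r0 r1 rs0 rs1; have := lev2_le r r0 r1.
  by have := lev2_gt _ rs0 rs1; have := cmin _ si; lra.
exists K0, K1, lev, D; split=> //; first split.
- move=> r r0; rewrite levK01 ?r0 // /lev1 r0; split=> //.
  by apply: MK1; move: r0; rewrite inE.
- move=> r r1; split; first exact: K10.
  move: (r1); rewrite inE => /andP[r0 /existsP[i /and3P[si ri /eqP bi]]].
  exists i; split=> //.
  by rewrite levK01 ?r1 ?orbT // /lev1 (negbTE r0) bi.
- move=> r r0 r1; have [/andP[sb bK] _] := Hbest r r0 r1.
  exists (best r); split=> //; rewrite (levK01 (r + _)) //.
  by rewrite /lev (negbTE r0) (negbTE r1).
move=> r i si; have bi := cmin _ si; have lri := lev_ge0 (r + s i).
have [r0|r0] := boolP (r \in K0).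
  by rewrite levK01 ?r0 // /lev1 r0; lra.
have [r1|r1] := boolP (r \in K1).
  by rewrite levK01 ?r1 ?orbT // /lev1 (negbTE r0); lra.
have [rK|] := boolP ((r + s i \in K0) || (r + s i \in K1)); last first.
  by move=> /norP[rs0 rs1]; apply/ltW/lev_strict.
rewrite (levK01 (r + _)) // /lev (negbTE r0) (negbTE r1) /=.
by apply: (Hbest r r0 r1).2; rewrite /Q si.
Qed.

Lemma uniform_gap (R : realType) (I : finType) (F : I -> R) :
  exists2 e : R, 0 < e & forall i, 0 < F i -> e <= F i.
Proof.
have [[i0 Fi0]|H] := pselect (exists i, 0 < F i).
  by have [i Fi mi] := @arg_minP _ _ _ i0 (fun i => 0 < F i) F Fi0; exists (F i).
by exists 1 => // i Fi; exfalso; apply: H; exists i.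
Qed.

Lemma val_ord_nat (m x : nat) : (x%:R : 'I_m.+2) = (x %% m.+2)%N :> nat.
Proof. exact: (@val_Zp_nat m.+2). Qed.

Lemma ord_nat_eq0 (m x : nat) : ((x%:R : 'I_m.+2) == 0) = (x %% m.+2 == 0)%N.
Proof. by rewrite -val_eqE /= val_ord_nat. Qed.

Lemma modn4_succ_cases (x : nat) :
  [\/ [/\ x %% 4 = 0, x.+1 %% 4 = 1 & x.+1 %/ 4 = x %/ 4],
      [/\ x %% 4 = 1, x.+1 %% 4 = 2 & x.+1 %/ 4 = x %/ 4],
      [/\ x %% 4 = 2, x.+1 %% 4 = 3 & x.+1 %/ 4 = x %/ 4] |
      x %% 4 = 3 /\ x.+1 %% 4 = 0]%N.
Proof.
have : (x %% 4 < 4)%N by rewrite ltn_mod.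
case E : (x %% 4)%N => [|[|[|[|//]]]] _;
  [apply: Or41|apply: Or42|apply: Or43|apply: Or44]; split; lia.
Qed.

(** With period [m.+1], adding [p * (m.+1 + m)] subtracts [p] and adds [2 p] periods, an even
    number, so the parity of the turn is kept. *)
Lemma anchor_shift (m p t : nat) :
  (t + p + p * (m.+1 + m) = p.*2 * m.+1 + t)%N.
Proof. by rewrite -mul2n; lia. Qed.

(** Terms [p] and [p + m] are the anchors of a window; they lie in one class modulo [m], whose level
    bounds all terms of the window from below. Either an anchor and a second term both sit at that
    level, or the two anchors share a value at most [eps] above it and no other term is smaller. *)
Lemma recurrent_dim_ge_long_edge (R : realType) (n k m0 p : nat)
    (a : 'rV[int]_n.+1) (b : nat -> R) (mu nu : R) :
  let m := m0.+2 in
  (forall i, (i <= n)%N -> (a 0 (inord i))%:~R = b i + mu * i%:R + nu) ->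
  (p + m <= n)%N -> b p = 0 -> b (p + m)%N = 0 ->
  (forall i, (i <= n)%N -> i != p -> i != (p + m)%N -> 0 < b i) ->
  (k <= 4 * recurrent_dim R a k + 4 * m)%N.
Proof.
move=> m ab pmn bp bpm bpos.
pose kap (t : nat) : 'I_m := t%:R.
have kapD t u : kap (t + u)%N = kap t + kap u by rewrite /kap natrD.
have kapm t : kap (t + m)%N = kap t.
  rewrite kapD; have -> : kap m = 0 by apply/eqP; rewrite ord_nat_eq0 modnn.
  by rewrite addr0.
have kap_val (r : 'I_m) x : kap (x * m + r)%N = r.
  apply: val_inj; apply: (eq_trans (val_ord_nat _ _)).
  by rewrite modnMDl modn_small.
pose s (i : 'I_n.+1) : 'I_m := kap i - kap p.
have sb i : s i != 0 -> 0 < b i.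
  move=> si; apply: bpos; first by rewrite -ltnS.
    by apply: contra si => /eqP; rewrite /s => ->; rewrite subrr.
  by apply: contra si => /eqP; rewrite /s => ->; rewrite kapm subrr.
have p1n : (p.+1 < n.+1)%N by rewrite /m in pmn; lia.
have [|K0 [K1 [lev [D [[K0P K1P K2P] lev_le lev_lt]]]]] :=
    @level_structure R 'I_m 'I_n.+1 s (fun i => b i) _ sb.
  exists (Ordinal p1n); rewrite /s /= -[p.+1]addn1 kapD addrC addKr.
  by rewrite ord_nat_eq0 modn_small.
have [e1 e10 gap1] := @uniform_gap R ('I_m * 'I_n.+1)%type
  (fun w => lev (w.1 + s w.2) + b w.2 - lev w.1).
have [e2 e20 gap2] := @uniform_gap R 'I_n.+1 (fun i => b i).
(* [eps] is at most every positive slack of the level inequalities and every positive [b i]. *)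
pose eps := Num.min e1 e2.
have eps0 : 0 < eps by rewrite lt_min e10.
have {}gap1 r i : lev r < lev (r + s i) + b i -> lev r + eps <= lev (r + s i) + b i.
  move=> lt; have := gap1 (r, i); rewrite /= subr_gt0 => /(_ lt).
  have : eps <= e1 by rewrite ge_min lexx.
  by lra.
have {}gap2 i : (i <= n)%N -> 0 < b i -> eps <= b i.
  rewrite -ltnS => ni bi; apply: le_trans (gap2 (Ordinal ni) bi).
  by rewrite ge_min lexx orbT.
(* [avail t]: the window whose left anchor is [t] has a third tight term,
   at [t + i - p], where the sequence sits at its level; the multiple of [m]
   replaces the subtraction of [p]. *)
pose avail t := [exists i : 'I_n.+1, [&& s i != 0,
   lev (kap t) == lev (kap t + s i) + b i & (kap t + s i \in K0) ||
   ((kap t + s i \in K1) && ~~ odd ((t + i + p * (m + m.-1)) %/ m))]].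
have avail_per t : avail (t + m + m)%N = avail t.
  apply: eq_existsb => i; rewrite !kapm.
  have -> : (t + m + m + i + p * (m + m.-1) = 2 * m + (t + i + p * (m + m.-1)))%N by lia.
  by rewrite divnMDl // oddD.
(* One turn later the far end of the same tight edge has the opposite parity, so if it ends in [K1],
   one of the two windows sees it on an even turn. *)
have avail_or t : kap t \notin K0 -> kap t \notin K1 -> ~~ avail t -> avail (t + m)%N.
  move=> t0 t1 nav; have [i [si iK lE]] := K2P _ t0 t1.
  apply/existsP; exists i; rewrite kapm si lE eqxx /=.
  case/orP: iK => [->//|iK1]; rewrite iK1 /=; apply/orP; right.
  have -> : (t + m + i + p * (m + m.-1) = 1 * m + (t + i + p * (m + m.-1)))%N by lia.
  rewrite divnMDl // oddD /= negbK; apply: contraR nav => od.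
  by apply/existsP; exists i; rewrite si lE eqxx iK1 od orbT.
pose tau t := (t %/ m)%N.
have tauS t : tau (t + m)%N = (tau t).+1 by rewrite /tau -{1}[m]mul1n divnDMl // addn1.
(* Over four turns of the residues, a class of [K1] has two free positions and
   every other class outside [K0] has one free value; when the window joining
   turns 0 and 1 (resp. 1 and 2) has no third tight term, that value is taken
   at both turns. The second free value of r in [K1] is numbered by r + D, so
   that each class of [K0], [K1] and the rest numbers one parameter. *)
pose free t := if kap t \in K0 then false else
  if kap t \in K1 then odd (tau t) else
  [|| tau t %% 4 == 1, (tau t %% 4 == 0) && ~~ avail t |
      (tau t %% 4 == 2) && ~~ avail (t + m)]%N.
(* Odd turns of [K1] are raised by [eps] even when the parameter is 0; this leaves room for the free
   values of anchors having a tight edge to them. *)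
pose h t := lev (kap t) +
  (if (kap t \in K1) && odd (tau t) then eps else 0).
pose idx t := (tau t %/ 4 * m +
  (if (kap t \in K1) && (tau t %% 4 == 3) then (kap t + D)%R else kap t))%N.
pose d := (m * (k %/ (4 * m)))%N.
(* Beyond the complete blocks of [4 * m] positions [insub] gives [None], and the parameter is 0. *)
pose f t : option 'I_d := if free t then insub (idx t) else None.
suff : (d <= recurrent_dim R a k)%N.
  have := ltn_ceil k (isT : (0 < 4 * m)%N); rewrite -/d => kd dd.
  have -> : (4 * recurrent_dim R a k + 4 * m = 4 * (recurrent_dim R a k + m))%N by lia.
  apply: leq_trans (ltnW kd) _; rewrite mulSn addnC mulnC -mulnA -mulnDr leq_mul2l /=.
  by rewrite leq_add2r.
apply: (@recurrent_dim_ge _ _ _ _ _ b mu nu h f eps) => //.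
  move=> i; have id := ltn_ord i.
  have ir : (i %% m < m)%N by rewrite ltn_mod.
  pose r : 'I_m := Ordinal ir; pose be := (i %/ m)%N.
  have iE : (i = be * m + r :> nat)%N by rewrite /= -divn_eq.
  have bek : (4 * m * be.+1 <= k)%N.
    apply: leq_trans (leq_trunc_div k (4 * m)); rewrite mulnC leq_mul2r; apply/orP; right.
    by rewrite ltn_divLR // mulnC.
  have fE t : free t -> idx t = i -> f t = Some i.
    by rewrite /f => -> ->; rewrite valK.
  have tauE x (l : 'I_m) : tau (x * m + l)%N = x.
    by rewrite /tau divnMDl // divn_small ?addn0 // ltn_ord.
  have tk x (l : 'I_m) : (x < 4)%N -> ((4 * be + x) * m + l < k)%N.
    move=> x4; apply: leq_trans bek; have lm := ltn_ord l.
    by rewrite mulnC; nia.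
  (* Parameter [be * m + r] is read at turn [4 * be + 1] of the class [r] or, when [r] is a root, at
     turn [4 * be + 3] of [r - D], which is in [K1]. *)
  have [r0|r0] := boolP (r \in K0).
    have [_ rD] := K0P _ r0; have [rD0 _] := K1P _ rD.
    exists ((4 * be + 3) * m + (r - D)%R)%N; first exact: tk.
    apply: fE; first by rewrite /free kap_val (negbTE rD0) rD tauE oddD oddM.
    rewrite /idx kap_val tauE rD; have -> : ((4 * be + 3) %% 4 = 3)%N by lia.
    by rewrite eqxx subrK [RHS]iE; congr (_ * m + _)%N; lia.
  exists ((4 * be + 1) * m + r)%N; first exact: tk.
  have b1 : ((4 * be + 1) %% 4 = 1)%N by lia.
  apply: fE; last first.
    by rewrite /idx kap_val tauE b1 andbF [RHS]iE; congr (_ * m + _)%N; lia.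
  rewrite /free kap_val (negbTE r0) tauE b1.
  by case: ifP => // _; rewrite oddD oddM.
move=> g j g01 jn.
pose y t := h t + eps * oapp g 0 (f t).
have g0 t : 0 <= oapp g 0 (f t) <= 1.
  by case: (f t) => [i|]; [apply: g01 | rewrite /= lexx ler01].
have y_ge_h t : h t <= y t.
  by have /andP[l _] := g0 t; rewrite lerDl mulr_ge0 // ltW.
have y_le_h t : y t <= h t + eps.
  by have /andP[_ l] := g0 t; rewrite lerD2l ler_piMr // ltW.
have y_h t : ~~ free t -> y t = h t.
  by move=> nf; rewrite /y /f (negbTE nf) mulr0 addr0.
have h_ge t : lev (kap t) <= h t by rewrite /h lerDl; case: ifP => // _; apply: ltW.
have y_ge t : lev (kap t) <= y t by apply: le_trans (h_ge t) _.
have y0 t : kap t \in K0 -> y t = lev (kap t).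
  move=> t0; rewrite y_h /free ?t0 // /h; case: ifP => [/andP[t1]|_]; last exact: addr0.
  by have [] := K1P _ t1; rewrite t0.
have y1e t : kap t \in K1 -> ~~ odd (tau t) -> y t = lev (kap t).
  move=> t1 ev; rewrite y_h.
    by rewrite /h (negbTE ev) andbF addr0.
  by rewrite /free t1 (negbTE ev); case: ifP.
have y1o t : kap t \in K1 -> odd (tau t) -> lev (kap t) + eps <= y t.
  by move=> t1 od; apply: le_trans (y_ge_h t); rewrite /h t1 od.
set r := kap (j + p)%N.
have kapj (i : 'I_n.+1) : kap (j + i)%N = r + s i.
  by rewrite /r !kapD /s -addrA [kap p + _]addrC subrK.
have kapq : kap (j + (p + m))%N = r by rewrite addnA kapm.
have pn : (p <= n)%N by lia.
have ppm : p != (p + m)%N by rewrite /m; lia.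
have same (i : 'I_n.+1) : s i = 0 -> lev r <= y (j + i)%N + b i.
  move=> si; have := y_ge (j + i)%N; rewrite kapj si addr0 => yl.
  apply: le_trans yl _; rewrite lerDl.
  have [->|ip] := eqVneq (nat_of_ord i) p; first by rewrite bp.
  have [->|iq] := eqVneq (nat_of_ord i) (p + m)%N; first by rewrite bpm.
  by apply/ltW/bpos => //; rewrite -ltnS.
have all_ge i : (i <= n)%N -> lev r <= y (j + i)%N + b i.
  rewrite -ltnS => ni; have [si|si] := eqVneq (s (Ordinal ni)) 0.
    exact: (same (Ordinal ni)).
  apply: le_trans (lev_le r _ si) _; rewrite -kapj /=.
  by rewrite lerD2r.
have two i1 i2 : (i1 <= n)%N -> (i2 <= n)%N -> i1 != i2 ->
    y (j + i1)%N + b i1 = lev r -> y (j + i2)%N + b i2 = lev r ->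
    min_twice_upto n (fun i => y (j + i)%N + b i).
  move=> n1 n2 i12 E1 E2; exists i1, i2.
  by split=> // i ni; rewrite ?E1 ?E2 all_ge.
have tight (i : 'I_n.+1) : s i != 0 ->
    y (j + p)%N = lev r \/ y (j + (p + m))%N = lev r ->
    y (j + i)%N + b i = lev r -> min_twice_upto n (fun i => y (j + i)%N + b i).
  have ni : (i <= n)%N by rewrite -ltnS.
  move=> si [E1|E1] E2.
    apply: (two p i pn ni) => //; last by rewrite bp addr0.
    by apply: contra si => /eqP; rewrite /s => ->; rewrite subrr.
  apply: (two (p + m)%N i pmn ni) => //; last by rewrite bpm addr0.
  by apply: contra si => /eqP; rewrite /s => <-; rewrite kapm subrr.
have tauq : tau (j + (p + m))%N = (tau (j + p)%N).+1 by rewrite addnA tauS.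
have [r0|r0] := boolP (r \in K0).
  by apply: (two p (p + m)%N) => //; rewrite ?bp ?bpm addr0 y0 // kapq.
(* The anchors lie on turns of opposite parity; the one on the even turn is at its level, tied with
   a term in a root class. *)
have [r1|r1] := boolP (r \in K1).
  have [_ [i [si ri lE]]] := K1P _ r1.
  apply: (tight i si); last by rewrite y0 kapj // lE (K0P _ ri).1 add0r.
  have [od|ev] := boolP (odd (tau (j + p)%N)).
    by right; rewrite y1e ?kapq // tauq /= od.
  by left; rewrite y1e.
have nh t : kap t = r -> h t = lev r by rewrite /h => ->; rewrite (negbTE r1) addr0.
have freeE t : kap t = r -> free t =
  [|| tau t %% 4 == 1, (tau t %% 4 == 0) && ~~ avail t |
      (tau t %% 4 == 2) && ~~ avail (t + m)]%N.
  by rewrite /free => ->; rewrite (negbTE r0) (negbTE r1).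
have fp := freeE (j + p)%N erefl.
have fq := freeE (j + (p + m))%N kapq.
rewrite tauq addnA avail_per -addnA in fq.
(* With a third tight term, one anchor at its level suffices. Turn 3 is never free; a window joining
   turns 0 and 1 has its left anchor at the level, one joining turns 1 and 2 its right anchor. *)
have [av|nav] := boolP (avail (j + p)%N).
  have /existsP[i /and3P[si /eqP lE iK]] := av.
  apply: (tight i si); last first.
    rewrite [RHS]lE -kapj; congr (_ + _); case/orP: iK => [ri|/andP[ri ev]].
      by rewrite y0 kapj.
    rewrite y1e ?kapj //; apply: contra ev.
    by rewrite addnAC anchor_shift -addnA divnMDl // oddD odd_double.
  case: (modn4_succ_cases (tau (j + p))) => [[h0 h1 _]|[h0 h1 _]|[h0 h1 _]|[h0 h1]].
  - by left; rewrite y_h ?nh // fp h0 av.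
  - by right; rewrite y_h ?nh // fq h1 av.
  - by right; rewrite y_h ?nh // fq h1.
  - by left; rewrite y_h ?nh // fp h0.
(* The window one turn later being available, the anchors are both free (on turns 0, 1 or 1, 2) or
   both not free, and in the free case [idx] gives them the same parameter. *)
have avq : avail (j + (p + m))%N by rewrite addnA avail_or.
rewrite -addnA avq in fp; rewrite avq in fq.
have Ypq : y (j + p)%N = y (j + (p + m))%N.
  rewrite /y !nh //; congr (_ + _ * oapp g 0 _); rewrite /f fp fq nav.
  rewrite /idx kapq tauq -/r (negbTE r1) !andFb.
  by case: (modn4_succ_cases (tau (j + p))) =>
    [[-> -> ->]|[-> -> ->]|[-> -> ->]|[-> ->]].
have yeps : y (j + p)%N <= lev r + eps by rewrite -(nh (j + p)%N).
(* A tight edge to a root would make the window available, and tight edges leaving [K0] and [K1]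
   aside are excluded by [lev_lt]; those into [K1] end on an odd turn, raised by [eps]. All other
   terms have slack at least [eps]. *)
have other i : (i <= n)%N -> i != p -> i != (p + m)%N -> lev r + eps <= y (j + i)%N + b i.
  move=> ni ip iq; have bi := bpos _ ni ip iq; have ei := gap2 _ ni bi.
  rewrite -ltnS in ni; have Hk := kapj (Ordinal ni).
  have [si|si] := eqVneq (s (Ordinal ni)) 0.
    by rewrite si addr0 in Hk; have := y_ge (j + i)%N; rewrite Hk; lra.
  have [lt|le] := ltP (lev r) (lev (r + s (Ordinal ni)) + b i).
    have := gap1 r (Ordinal ni) lt; have := y_ge (j + i)%N; rewrite Hk /=; lra.
  have lE : lev r = lev (r + s (Ordinal ni)) + b i.
    by apply/eqP; rewrite eq_le le lev_le.
  have rs0 : r + s (Ordinal ni) \notin K0.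
    apply: contra nav => rs; apply/existsP; exists (Ordinal ni).
    by rewrite si rs /= -lE eqxx.
  have [rs1|rs1] := boolP (r + s (Ordinal ni) \in K1); last first.
    by have := lev_lt r (Ordinal ni) si r0 r1 rs0 rs1; rewrite /= -lE ltxx.
  have od : odd (tau (j + i)%N).
    apply: contraR nav => ev; apply/existsP; exists (Ordinal ni).
    rewrite si rs1 /= -lE eqxx /=; apply/orP; right.
    by rewrite addnAC anchor_shift -addnA divnMDl // oddD odd_double.
  have := y1o (j + i)%N; rewrite Hk => /(_ rs1 od); rewrite lE; lra.
have minp i : (i <= n)%N -> y (j + p)%N <= y (j + i)%N + b i.
  move=> ni; have [->|ip] := eqVneq i p; first by rewrite bp addr0.
  have [->|iq] := eqVneq i (p + m)%N; first by rewrite bpm addr0 -Ypq lexx.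
  by apply: le_trans yeps _; apply: other.
have minq i : (i <= n)%N -> y (j + (p + m))%N + b (p + m)%N <= y (j + i)%N + b i.
  by rewrite bpm addr0 -Ypq; apply: minp.
exists p, (p + m)%N; split; [exact: ppm | by [] | | exact: minq].
by move=> i ni; rewrite bp addr0; apply: minp.
Qed.

(* The chord over a non-convex index that is lowest there supports the whole
   graph. *)
Lemma supporting_chord (R : realType) (n i : nat) (A : nat -> R) :
  (i.+2 <= n)%N -> A i + A i.+2 <= A i.+1 *+ 2 ->
  exists (p m0 : nat) (mu nu : R), [/\ (p + m0.+2 <= n)%N,
    forall l, (l <= n)%N -> mu * l%:R + nu <= A l,
    A p = mu * p%:R + nu & A (p + m0.+2)%N = mu * (p + m0.+2)%:R + nu].
Proof.
move=> i2n Ai; pose v : R := i.+1%:R.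
pose P (w : 'I_n.+1 * 'I_n.+1) := (w.1 < i.+1 < w.2)%N.
pose H (w : 'I_n.+1 * 'I_n.+1) : R :=
  (A w.1 * (w.2%:R - v) + A w.2 * (v - w.1%:R)) / (w.2%:R - w.1%:R).
have i0n : (i < n.+1)%N by lia.
have P0 : P (Ordinal i0n, Ordinal (i2n : i.+2 < n.+1)%N) by rewrite /P /=; lia.
have [[p q] /= /andP[pi iq] minH] := @arg_minP _ _ _ _ P H P0.
rewrite /= in pi iq.
have ltv (x y : nat) : (x < y)%N -> (x%:R : R) < y%:R by rewrite ltr_nat.
have pv := ltv _ _ pi; have vq := ltv _ _ iq; rewrite -/v in pv vq.
pose mu := (A q - A p) / (q%:R - p%:R); pose nu := A p - mu * p%:R.
have pE : A p = mu * p%:R + nu by rewrite /nu; ring.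
have qE : A q = mu * q%:R + nu.
  by rewrite /nu /mu; field; rewrite subr_eq0 gt_eqF //; lra.
have HE : H (p, q) = mu * v + nu.
  by rewrite /H /= pE qE; field; rewrite subr_eq0 gt_eqF //; lra.
have Hle (w : 'I_n.+1 * 'I_n.+1) : P w -> (mu * v + nu) * (w.2%:R - w.1%:R) <=
    A w.1 * (w.2%:R - v) + A w.2 * (v - w.1%:R).
  move=> Pw; have := minH w Pw; rewrite HE /H ler_pdivlMr // subr_gt0 ltr_nat.
  by move: Pw => /andP[]; lia.
exists p, (q - p - 2)%N, mu, nu.
have pq : (p + (q - p - 2).+2 = q)%N by lia.
rewrite {}pq; split=> //; first by rewrite -ltnS.
move=> l; rewrite -ltnS => ln.
(* For [l] on one side of [i + 1], the chord from [l] to the end on the other side is not lower at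
   [i + 1]; for [l = i + 1], the chord over [i] and [i + 2] and the failure of strict convexity
   suffice. *)
have [li|li|li] := ltngtP l i.+1.
- have := Hle (Ordinal ln, q) ltac:(by rewrite /P /= li).
  rewrite /= qE => Hl; have := ltv _ _ li; rewrite -/v => lv.
  rewrite -(@ler_pM2r _ (q%:R - v)) ?subr_gt0 //; lra.
- have := Hle (p, Ordinal ln) ltac:(by rewrite /P /= pi).
  rewrite /= pE => Hl; have := ltv _ _ li; rewrite -/v => lv.
  rewrite -(@ler_pM2r _ (v - p%:R)) ?subr_gt0 //; lra.
have := Hle _ P0; rewrite /= li -/v.
have -> : i%:R = v - 1 :> R by rewrite /v -natr1 addrK.
have -> : i.+2%:R = v + 1 :> R by rewrite /v -natr1.
by move: Ai; rewrite mulr2n; lra.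
Qed.

Lemma recurrent_dim_not_strictly_convex (R : realType) (n i : nat)
    (a : 'rV[int]_n.+1) :
  (i.+2 <= n)%N ->
  a 0 (inord i) + a 0 (inord i.+2) <= a 0 (inord i.+1) *+ 2 ->
  exists C, forall k, (k <= 4 * recurrent_dim R a k + C)%N.
Proof.
move=> i2n ai; pose A l : R := (a 0 (inord l))%:~R.
have Ai : A i + A i.+2 <= A i.+1 *+ 2 by rewrite /A -rmorphD -rmorphMn /= ler_int.
have [p [m0 [mu [nu [pmn bge pE qE]]]]] := supporting_chord i2n Ai.
pose b l := A l - (mu * l%:R + nu).
have ab l : (l <= n)%N -> (a 0 (inord l))%:~R = b l + mu * l%:R + nu.
  by rewrite /b /A => _; ring.
have b0 l : (l <= n)%N -> 0 <= b l by move=> ln; rewrite subr_ge0 bge.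
have bp : b p = 0 by rewrite /b pE subrr.
have bq : b (p + m0.+2)%N = 0 by rewrite /b qE subrr.
have [[l [ln lp lq bl]]|H] := pselect (exists l,
    [/\ (l <= n)%N, l != p, l != (p + m0.+2)%N & b l = 0]); last first.
  exists (4 * m0.+2)%N => k; apply: (recurrent_dim_ge_long_edge k ab pmn bp bq).
  move=> l ln lp lq; rewrite lt_neqAle b0 // andbT eq_sym.
  by apply/eqP => bl; apply: H; exists l.
exists 0%N => k; rewrite addn0.
case: (ltngtP l p) lp => // lp _.
  by apply: (recurrent_dim_ge_three_zeros k ab b0 _ _ bl bp bq); lia.
case: (ltngtP l (p + m0.+2)) lq => // lq _.
  by apply: (recurrent_dim_ge_three_zeros k ab b0 _ _ bp bl bq); lia.
by apply: (recurrent_dim_ge_three_zeros k ab b0 _ _ bp bq bl); lia.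
Qed.

(** * Entropy *)

Lemma cvg_addM_harmonic (R : realType) (l c : R) :
  ((fun k => l + c * harmonic k) @ \oo --> l)%classic.
Proof.
have : ((fun k => l + c * harmonic k) @ \oo --> l + c * 0)%classic.
  by apply: cvgD; [exact: cvg_cst | apply: cvgMl_tmp; exact: cvg_harmonic].
by rewrite mulr0 addr0.
Qed.

Lemma entropy_squeeze (R : realType) (n C : nat) (a : 'rV[int]_n.+1) (l : R) :
  (forall k, `|(recurrent_dim R a k)%:R - k%:R * l| <= C%:R :> R) ->
  tropical_entropy R a = l.
Proof.
move=> H; rewrite /tropical_entropy; apply: cvg_lim => //; rewrite -cvg_shiftS.
apply: (@squeeze_cvgr _ _ _ _ (fun k => l + - C%:R * harmonic k)
                              (fun k => l + C%:R * harmonic k)).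
- apply: nearW => k; rewrite /harmonic /=.
  have k0 : (0 : R) < k.+1%:R by rewrite ltr0n.
  have := H k.+1; rewrite ler_norml => /andP[h1 h2].
  rewrite ler_pdivlMr // ler_pdivrMr // !mulrDl -!mulrA mulVf ?gt_eqF // mulr1.
  by rewrite [l * _]mulrC; apply/andP; split; lra.
- exact: cvg_addM_harmonic.
- exact: cvg_addM_harmonic.
Qed.

Lemma entropy_ge (R : realType) (n C : nat) (a : 'rV[int]_n.+1) :
  (forall k, (k <= 4 * recurrent_dim R a k + C)%N) ->
  0 < tropical_entropy R a -> 1 / 4 <= tropical_entropy R a.
Proof.
move=> H; rewrite /tropical_entropy; set u := fun k : nat => _.
(* For a divergent sequence [limn] is the default value 0, which positivity excludes. *)
have [cu _|/dvgP ->] := pselect (cvgn u); last by rewrite ltxx.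
have hl := @cvg_addM_harmonic R (1 / 4) (- (C%:R / 4)).
have us : ((fun k => u k.+1) @ \oo --> limn u)%classic by rewrite (cvg_shiftS u).
rewrite -(cvg_lim _ hl) // -(cvg_lim _ us) //.
apply: ler_lim; [by apply/cvg_ex; exists (1/4) | by apply/cvg_ex; exists (limn u) |].
apply: nearW => k; rewrite /u /harmonic /=.
have k0 : (0 : R) < k.+1%:R by rewrite ltr0n.
rewrite ler_pdivlMr // mulrDl -(mulrA _ k.+1%:R^-1) mulVf ?gt_eqF // mulr1.
by have := H k.+1; rewrite -(ler_nat R) natrD natrM; lra.
Qed.

Theorem theorem0p4 (R : realType) :
  (forall (n : nat) (a : 'rV[int]_n.+1), (1 <= n)%N ->
     0 < tropical_entropy R a -> 1 / 4 <= tropical_entropy R a) /\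
  (exists (n : nat) (a : 'rV[int]_n.+1), (1 <= n)%N /\
     tropical_entropy R a = 1 / 4).
Proof.
split=> [n a _ H0|].
  have [[i [i2n ai]]|cvx] := pselect (exists i, (i.+2 <= n)%N /\
      a 0 (inord i) + a 0 (inord i.+2) <= a 0 (inord i.+1) *+ 2).
    have [C HC] := recurrent_dim_not_strictly_convex R i2n ai.
    exact: (entropy_ge HC).
  suff H : tropical_entropy R a = 0 by rewrite H ltxx in H0.
  apply: (@entropy_squeeze _ _ n) => k; rewrite mulr0 subr0 ger0_norm // ler_nat.
  apply: recurrent_dim_strictly_convex => i i2n.
  by rewrite ltNge; apply/negP => ai; apply: cvx; exists i.
pose a : 'rV[int]_3 := \row_(i < 3) (i == 1%N :> nat)%:R.
exists 2%N, a; split=> //.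
have [|C HC] := @recurrent_dim_not_strictly_convex R 2 0 a isT.
  by rewrite !mxE !inordK.
(* The bounds [k <= 4 * d + C] and [4 * d <= k + 12] put [d] within [C + 12] of [k / 4]. *)
apply: (@entropy_squeeze _ _ (C + 12)) => k; rewrite ler_norml.
have := HC k; have := recurrent_dim_010 R k; rewrite -/a.
set d := recurrent_dim R a k => d1 d2.
have d3 : (4 * d <= k + 12)%N by lia.
move: d2 d3; rewrite -2!(ler_nat R) natrD natrM natrD [(C + 12)%:R]natrD => d2 d3.
have C0 : (0 : R) <= C%:R by [].
by apply/andP; split; lra.
Qed.
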